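(* Let $\mathbb{K}=\mathbb{R}$ or $\mathbb{C}$ and let $A\in\mathbb{K}^{m\times n}$, $B\in\mathbb{K}^{n\times k}$ be two matrices. The following conditions are equivalent: (i) $B^{+}A^{+}$ is a $\{1,2\}$-inverse of $AB$; (ii) $AB$ is a $\{1,2\}$-inverse of $B^{+}A^{+}$; (iii) $\mathcal{C}(A^{+}AB)\subset\mathcal{C}(B)$; (iv) $\mathcal{C}(BB^{+}A^{+})\subset\mathcal{C}(A^{+})$; (v) the principal angles between $\mathcal{C}(A^* )$ and $\mathcal{C}(B)$ belong to the set $\{0,\frac{\pi}{2}\}$; (vi) $A^{+}ABB^{+}$ is an orthogonal projection; (vii) $BB^{+}A^{+}A$ is an orthogonal projection; (viii) the matrices $A^{+}A$ and $BB^{+}$ commute; (ix) the matrices $A^{+}A$ and $BB^{+}$ are simultaneously diagonalizable; (x) $A^{+}ABB^{+}=2A^{+}A\,(A^{+}A+BB^{+})^{+}BB^{+}$; (xi) $A^{+}ABB^{+}A^{+}ABB^{+}=BB^{+}A^{+}A$; (xii) the eigenvalues of $A^{+}ABB^{+}A^{+}A$ belong to the set $\{0,1\}$.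
   Context: $M^*$ is the conjugate transpose, $M^{+}$ the Moore--Penrose pseudoinverse, and $\mathcal{C}(M)$ the column space of $M$. A matrix $X$ is a $\{1,2\}$-inverse of $M$ if $MXM=M$ and $XMX=X$. An orthogonal projection is a matrix $P$ with $P^2=P=P^*$. If $U,V$ are matrices with $n$ rows and with orthonormal columns, the cosines of the principal angles (in $[0,\frac{\pi}{2}]$) between $\mathcal{C}(U)$ and $\mathcal{C}(V)$ are the singular values (zeros included) of $V^*U$; this does not depend on the choice of orthonormal bases. If one of the subspaces is zero there are no principal angles. *)

(* Defs.v *)
From HB Require Import structures.
From mathcomp Require Import all_boot all_order all_algebra.
From mathcomp Require Import all_classical all_reals all_analysis.
From mathcomp Require Import complex.

Set Implicit Arguments.
Unset Strict Implicit.
Unset Printing Implicit Defensive.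

Import Order.TTheory GRing.Theory Num.Theory.
Local Open Scope ring_scope.

Variant base_field := RealField | ComplexField.

Definition RorC (R : realType) (b : base_field) : numFieldType :=
  match b with RealField => R | ComplexField => R[i] end.

Definition RorC_conj (R : realType) (b : base_field) :
    RorC R b -> RorC R b :=
  match b with RealField => id | ComplexField => @conjc R end.

Definition of_real (R : realType) (b : base_field) : R -> RorC R b :=
  match b with RealField => id | ComplexField => real_complex R end.
Arguments of_real {R} b.

Section Matrices.
Context {R : realType} {b : base_field}.
Local Notation K := (RorC R b).

Definition ctmx m n (M : 'M[K]_(m, n)) : 'M[K]_(n, m) :=
  (map_mx (@RorC_conj R b) M)^T.

Definition penrose m n (M : 'M[K]_(m, n)) (X : 'M[K]_(n, m)) : Prop :=
  [/\ M *m X *m M = M, X *m M *m X = X,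
      ctmx (M *m X) = M *m X & ctmx (X *m M) = X *m M].

(* Well defined: see [mp_invP] and [penrose_uniq]. MathComp's [pinvmx] is only
   some generalized inverse, not the Moore-Penrose one. *)
Definition mp_inv m n (M : 'M[K]_(m, n)) : 'M[K]_(n, m) :=
  xget 0 [set X | penrose M X].

Definition is_12_inverse m n (X : 'M[K]_(n, m)) (M : 'M[K]_(m, n)) : Prop :=
  M *m X *m M = M /\ X *m M *m X = X.

(* MathComp's [<=%MS] compares row spaces, hence the transpositions. *)
Definition colsp_sub n p q (X : 'M[K]_(n, p)) (Y : 'M[K]_(n, q)) : bool :=
  (X^T <= Y^T)%MS.

Definition colsp_eq n p q (X : 'M[K]_(n, p)) (Y : 'M[K]_(n, q)) : bool :=
  (X^T == Y^T)%MS.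

Definition orthogonal_projection n (P : 'M[K]_n) : Prop :=
  P *m P = P /\ ctmx P = P.

Definition orthonormal_cols n p (U : 'M[K]_(n, p)) : Prop :=
  ctmx U *m U = 1%:M.

(* sigma is one of the min(p, q) diagonal entries of the factor S in a
   singular value decomposition M = W S V^*. *)
Definition singular_value p q (M : 'M[K]_(p, q)) (sigma : R) : Prop :=
  exists (W : 'M[K]_p) (S : 'M[R]_(p, q)) (V : 'M[K]_q),
    [/\ orthonormal_cols W, orthonormal_cols V,
        forall (i : 'I_p) (j : 'I_q), if i == j :> nat then 0 <= S i j else S i j == 0,
        M = W *m map_mx (of_real b) S *m ctmx V
      & exists (i : 'I_p) (j : 'I_q), i = j :> nat /\ S i j = sigma].

Definition principal_angle n p q (X : 'M[K]_(n, p)) (Y : 'M[K]_(n, q))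
    (theta : R) : Prop :=
  0 <= theta <= pi / 2 /\
  exists (U : 'M[K]_(n, \rank X)) (V : 'M[K]_(n, \rank Y)),
    [/\ orthonormal_cols U, colsp_eq U X,
        orthonormal_cols V, colsp_eq V Y
      & singular_value (ctmx V *m U) (cos theta)].

Lemma RorC_conjD : {morph @RorC_conj R b : x y / x + y}.
Proof. by case: b => x y //=; rewrite rmorphD. Qed.

Lemma RorC_conjM : {morph @RorC_conj R b : x y / x * y}.
Proof. by case: b => x y //=; rewrite rmorphM. Qed.

Lemma RorC_conjK : involutive (@RorC_conj R b).
Proof. by case: b => x //=; rewrite conjcK. Qed.

Lemma RorC_conj_ge0 (x : K) : 0 <= x * RorC_conj x.
Proof.
case: b x => x /=; first by rewrite -expr2 sqr_ge0.
exact: (mul_conjC_ge0 (x : R[i])).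
Qed.

Lemma RorC_conj_eq0 (x : K) : (x * RorC_conj x == 0) = (x == 0).
Proof.
have c0 : RorC_conj 0 = 0 :> K.
  by apply: (addIr (RorC_conj 0)); rewrite -RorC_conjD !add0r.
rewrite mulf_eq0 orbC; case: eqP => //= h.
by rewrite -(RorC_conjK x) h c0 eqxx.
Qed.

Lemma ctmxK m n (M : 'M[K]_(m, n)) : ctmx (ctmx M) = M.
Proof. by apply/matrixP => i j; rewrite !mxE RorC_conjK. Qed.

Lemma ctmx_mul m n p (M : 'M[K]_(m, n)) (N : 'M[K]_(n, p)) :
  ctmx (M *m N) = ctmx N *m ctmx M.
Proof.
have c0 : RorC_conj 0 = 0 :> K.
  by apply: (addIr (RorC_conj 0)); rewrite -RorC_conjD !add0r.
apply/matrixP => i j; rewrite !mxE (big_morph _ RorC_conjD c0).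
by apply: eq_bigr => k _; rewrite !mxE RorC_conjM mulrC.
Qed.

Lemma mul_ctmx_eq0 m n (M : 'M[K]_(m, n)) : M *m ctmx M = 0 -> M = 0.
Proof.
move=> h; apply/matrixP => i j; have /eqP := congr1 (fun N : 'M[K]_m => N i i) h.
rewrite !mxE psumr_eq0 => [|k _]; last by rewrite !mxE RorC_conj_ge0.
by move/allP/(_ j (mem_index_enum _)); rewrite /= !mxE RorC_conj_eq0 => /eqP.
Qed.

Lemma row_free_gram m n (M : 'M[K]_(m, n)) :
  row_free M -> M *m ctmx M \in unitmx.
Proof.
move=> Mf; rewrite -row_free_unit -kermx_eq0; apply/eqP.
have kM : kermx (M *m ctmx M) *m M = 0.
  apply: mul_ctmx_eq0.
  by rewrite ctmx_mul mulmxA -(mulmxA (kermx _)) mulmx_ker mul0mx.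
by apply: (row_free_inj Mf); rewrite /= kM mul0mx.
Qed.

Lemma penrose_uniq m n (M : 'M[K]_(m, n)) X Y :
  penrose M X -> penrose M Y -> X = Y.
Proof.
move=> [x1 x2 x3 x4] [y1 y2 y3 y4].
have MXY : M *m X = M *m Y.
  rewrite -x3 -{1}y1 -mulmxA ctmx_mul x3 y3.
  by rewrite mulmxA x1.
have XMY : X *m M = Y *m M.
  rewrite -x4 -{1}y1 !mulmxA -(mulmxA (X *m M)) ctmx_mul x4 y4.
  by rewrite -!mulmxA (mulmxA M) x1.
by rewrite -x2 XMY -mulmxA MXY mulmxA y2.
Qed.

Lemma ctmx1 n : ctmx 1%:M = 1%:M :> 'M[K]_n.
Proof.
suff h : ctmx (ctmx 1%:M *m 1%:M) = ctmx 1%:M *m 1%:M :> 'M[K]_n.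
  by move: h; rewrite !mulmx1 ctmxK.
by rewrite ctmx_mul ctmxK.
Qed.

Lemma ctmx_inv n (H : 'M[K]_n) :
  H \in unitmx -> ctmx H = H -> ctmx (invmx H) = invmx H.
Proof.
move=> Hu HH; rewrite -[LHS]mulmx1 -(mulmxV Hu) mulmxA.
by rewrite -{2}HH -ctmx_mul mulmxV // ctmx1 mul1mx.
Qed.

Lemma penrose_ex m n (M : 'M[K]_(m, n)) : exists X, penrose M X.
Proof.
have DDu := row_free_gram (row_base_free M).
have CCu : ctmx (col_base M) *m col_base M \in unitmx.
  rewrite -{2}(ctmxK (col_base M)); apply: row_free_gram.
  have /row_fullP[C' CC'] := col_base_full M.
  by apply/row_freeP; exists (ctmx C'); rewrite -ctmx_mul CC' ctmx1.
move: (col_base M) (row_base M) (mulmx_base M) DDu CCu.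
move: (\rank M) => r C D MCD DDu CCu.
set DD := D *m ctmx D in DDu; set CC := ctmx C *m C in CCu.
have DDh : ctmx (invmx DD) = invmx DD.
  by apply: ctmx_inv; rewrite // ctmx_mul ctmxK.
have CCh : ctmx (invmx CC) = invmx CC.
  by apply: ctmx_inv; rewrite // ctmx_mul ctmxK.
pose X := ctmx D *m invmx DD *m invmx CC *m ctmx C.
have MX : M *m X = C *m invmx CC *m ctmx C.
  by rewrite -MCD /X !mulmxA -(mulmxA C D) -/DD -(mulmxA C DD) mulmxV // mulmx1.
have XM : X *m M = ctmx D *m invmx DD *m D.
  by rewrite -MCD /X !mulmxA -(mulmxA _ (ctmx C) C) -/CC -(mulmxA _ (invmx CC) CC) mulVmx // mulmx1.
exists X; split.
- by rewrite MX -MCD !mulmxA -(mulmxA _ (ctmx C) C) -/CC -(mulmxA _ (invmx CC) CC) mulVmx // mulmx1.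
- rewrite XM /X !mulmxA -(mulmxA _ D (ctmx D)) -/DD -(mulmxA _ (invmx DD) DD) mulVmx //.
  by rewrite mulmx1.
- by rewrite MX !ctmx_mul ctmxK CCh mulmxA.
- by rewrite XM !ctmx_mul ctmxK DDh mulmxA.
Qed.

Lemma mp_invP m n (M : 'M[K]_(m, n)) : penrose M (mp_inv M).
Proof. exact: (xgetPex 0 (penrose_ex M)). Qed.

End Matrices.

(* Main.v *)
From HB Require Import structures.
Require Import Defs.
From mathcomp Require Import all_boot all_order all_algebra.
From mathcomp Require Import all_classical all_reals all_analysis.
From mathcomp Require Import complex spectral sesquilinear.

Set Implicit Arguments.
Unset Strict Implicit.
Unset Printing Implicit Defensive.

Import Order.TTheory GRing.Theory Num.Theory.
Local Open Scope ring_scope.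

(** Write P = A^+ A and Q = B B^+ for the orthogonal projections onto the
    column spaces of A^H and of B, where ^H is the conjugate transpose.  Each of
    the twelve conditions says, in its own way, that P and Q commute, and each is
    shown equivalent to that.

    The algebraic conditions reduce to two criteria.  First, P and Q commute as soon
    as P Q is idempotent ([proj_mul_idemP]): then X = P Q - P Q P satisfies
    X X^H = 0, so P Q = P Q P is Hermitian.  Second, P Q is Hermitian exactly when
    P Q = Q P, because (P Q)^H = Q P.  Multiplying (i) by A^+ on the left and by
    B^+ on the right, or rewriting the inclusions (iii) and (iv) as Q P Q = P Q
    and P Q P = Q P, gives idempotence.  For (x), put S = P + Q; the column space
    of S contains that of P, so P S^+ Q = P S^+ (S - P) = P - P S^+ P is always
    Hermitian, while S (P Q) = 2 P Q when P and Q commute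
    ([proj_parallel_sumP]).

    The spectral conditions rest on partial isometries: N N^H N = N if and only
    if all singular values of N are 0 or 1 ([partial_isometryP]), since the
    left-hand side replaces every singular value by its cube.  For (v), take
    N = V^H U with P = U U^H and Q = V V^H; the cosines of the angles are the
    singular values of N, and N N^H N = N is (Q P)^2 = Q P read in the bases U
    and V.  For (xii), take N = Q P; the eigenvalues of P Q P = N^H N include the
    squares of the singular values of N, and N N^H N = Q P Q P.

    Going from (v) or (xii) to commutation requires that singular values
    exist, that is, the singular value decomposition over R and over C
    ([svd_ex]).  It is obtained by deflation: an eigenvector of M^H M for a
    nonzero eigenvalue gives a pair of singular vectors, which are completed to
    unitary matrices, and what remains is a smaller matrix. *)

(** * The scalar field *)

Section Scalars.
Context {R : realType} {b : base_field}.
Local Notation K := (RorC R b).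

Let conjB : {morph @RorC_conj R b : x y / x - y}.
Proof. by case: b => x y //=; rewrite rmorphB. Qed.

Let conj_monoid : monoid_morphism (@RorC_conj R b).
Proof.
split; last exact: RorC_conjM.
by case: b => //; exact: (rmorph1 (@conjc R)).
Qed.

HB.instance Definition _ :=
  GRing.isZmodMorphism.Build K K (@RorC_conj R b) conjB.
HB.instance Definition _ :=
  GRing.isMonoidMorphism.Build K K (@RorC_conj R b) conj_monoid.

Let of_realB : {morph @of_real R b : x y / x - y}.
Proof. by case: b => x y //=; rewrite rmorphB. Qed.

Let of_real_monoid : monoid_morphism (@of_real R b).
Proof.
split; first by case: b => //; exact: (rmorph1 (real_complex R)).
by case: b => // x y; exact: (rmorphM (real_complex R)).
Qed.

HB.instance Definition _ :=
  GRing.isZmodMorphism.Build R K (@of_real R b) of_realB.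
HB.instance Definition _ :=
  GRing.isMonoidMorphism.Build R K (@of_real R b) of_real_monoid.

Lemma conj_of_real (x : R) : RorC_conj (of_real b x) = of_real b x.
Proof. by case: b => //; exact: conjc_real. Qed.

Lemma of_real_inj : injective (@of_real R b).
Proof. exact: fmorph_inj. Qed.

Lemma ler_of_real (x y : R) : (of_real b x <= of_real b y) = (x <= y).
Proof. by case: b => //; exact: lecR. Qed.

Lemma nonneg_sqr (x : K) :
  0 <= x -> exists2 s : R, 0 <= s & x = of_real b (s ^+ 2).
Proof.
case: b x => /= x x0.
  by exists (Num.sqrt x); rewrite ?sqrtr_ge0 ?sqr_sqrtr.
have /complex_realP[r xr] := ger0_real x0.
move: x0; rewrite xr lecR => r0.
by exists (Num.sqrt r); rewrite ?sqrtr_ge0 ?sqr_sqrtr.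
Qed.

End Scalars.

(** * The conjugate transpose *)

Section ConjugateTranspose.
Context {R : realType} {b : base_field}.
Local Notation K := (RorC R b).

Lemma ctmxB m n (M N : 'M[K]_(m, n)) : ctmx (M - N) = ctmx M - ctmx N.
Proof. by rewrite /ctmx map_mxB linearB. Qed.

Lemma ctmxD m n (M N : 'M[K]_(m, n)) : ctmx (M + N) = ctmx M + ctmx N.
Proof. by rewrite /ctmx map_mxD linearD. Qed.

Lemma ctmx0 m n : ctmx (0 : 'M[K]_(m, n)) = 0.
Proof. by rewrite /ctmx map_mx0 trmx0. Qed.

Lemma ctmxZ (a : K) m n (M : 'M[K]_(m, n)) :
  ctmx (a *: M) = RorC_conj a *: ctmx M.
Proof. by rewrite /ctmx map_mxZ linearZ. Qed.

Lemma ctmx_row_mx m n1 n2 (M : 'M[K]_(m, n1)) (N : 'M[K]_(m, n2)) :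
  ctmx (row_mx M N) = col_mx (ctmx M) (ctmx N).
Proof. by rewrite /ctmx map_row_mx tr_row_mx. Qed.

Lemma ctmx_block_mx m1 m2 n1 n2 (M : 'M[K]_(m1, n1)) (N : 'M[K]_(m1, n2))
    (O : 'M[K]_(m2, n1)) (P : 'M[K]_(m2, n2)) :
  ctmx (block_mx M N O P) =
    block_mx (ctmx M) (ctmx O) (ctmx N) (ctmx P).
Proof. by rewrite /ctmx map_block_mx tr_block_mx. Qed.

Lemma ctmx_of_real m n (S : 'M[R]_(m, n)) :
  ctmx (map_mx (of_real b) S) = map_mx (of_real b) S^T.
Proof. by apply/matrixP => i j; rewrite !mxE conj_of_real. Qed.

Lemma mulctmx_eq0 m n (M : 'M[K]_(m, n)) : ctmx M *m M = 0 -> M = 0.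
Proof.
by rewrite -{2}[M]ctmxK => /mul_ctmx_eq0 h; rewrite -[M]ctmxK h ctmx0.
Qed.

Lemma orthonormal_rank n p (U : 'M[K]_(n, p)) :
  orthonormal_cols U -> \rank U = p.
Proof.
move=> Uo; apply/eqP; rewrite eqn_leq rank_leq_col /=.
by rewrite -[X in (X <= _)%N](mxrank1 K p) -Uo mxrankM_maxr.
Qed.

Lemma ctmx_unitary_right n (U : 'M[K]_n) :
  orthonormal_cols U -> U *m ctmx U = 1%:M.
Proof. exact: mulmx1C. Qed.

Lemma colsp_subP n p q (X : 'M[K]_(n, p)) (Y : 'M[K]_(n, q)) :
  reflect (exists D, X = Y *m D) (colsp_sub X Y).
Proof.
apply: (iffP submxP) => [[D /(congr1 trmx)]|[D ->]].
  by rewrite trmx_mul !trmxK => ->; exists D^T.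
by exists D^T; rewrite trmx_mul.
Qed.

End ConjugateTranspose.

(** * Eigenvalues of Hermitian matrices *)

Section Hermitian.
Context {R : realType}.

(** In a spectral decomposition of H, the diagonal entries are real eigenvalues
    and they cannot all vanish. *)
Lemma complex_hermitian_eigenvalue n (H : 'M[R[i]]_n) :
  ctmx (b := ComplexField) H = H -> H != 0 ->
  exists2 r : R, r != 0 & eigenvalue H r%:C%C.
Proof.
move=> Hh H0.
have Hs : H \is hermsymmx.
  apply/is_hermitianmxP; rewrite expr0 scale1r -{1}Hh.
  by apply/matrixP => i j; rewrite !mxE.
have /orthomx_spectralP Hd := hermitian_normalmx Hs.
have := hermitian_spectral_diag_real Hs.
move: (spectralmx H) (spectral_unit H) (spectral_diag H) Hd => P Pu d Hd dr.
have [i di] : exists i, d 0 i != 0.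
  apply/existsP; apply: contraNT H0; rewrite negb_exists => /forallP d0.
  have dz : d = 0.
    by apply/rowP => i; rewrite mxE; apply/eqP; have := d0 i; rewrite negbK.
  by rewrite Hd dz raddf0 mulmx0 mul0mx.
have /mxOverP/(_ 0 i)/complex_realP[r rd] := dr.
exists r; first by apply: contraNneq di => r0; rewrite rd r0.
rewrite -rd; apply/eigenvalueP; exists (row i P); last first.
  apply: contraTneq isT => r0; have := congr1 (row i) (mulmxV Pu).
  rewrite row_mul r0 mul0mx rowE mulmx1 => /rowP/(_ i)/eqP.
  by rewrite !mxE !eqxx eq_sym oner_eq0.
rewrite [in LHS]Hd !mulmxA -row_mul mulmxV //.
by rewrite rowE mulmx1 -rowE row_diag_mx -scalemxAl -rowE.
Qed.

Context {b : base_field}.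
Local Notation K := (RorC R b).

(** Over the reals, the complexified matrix has a nonzero eigenvalue that is
    real, and eigenvalues of a matrix in a subfield that lie in this subfield
    are already eigenvalues there. *)
Lemma hermitian_eigenvalue n (H : 'M[K]_n) :
  ctmx H = H -> H != 0 ->
  exists2 r : R, r != 0 & eigenvalue H (of_real b r).
Proof.
case: b H => H Hh H0; last exact: complex_hermitian_eigenvalue.
have [||r r0 ev] :=
  complex_hermitian_eigenvalue (H := map_mx (real_complex R) H).
- apply/matrixP => i j; rewrite !mxE /=.
  have /matrixP/(_ i j) := Hh; rewrite !mxE /= => <-.
  exact: conjc_real.
- by rewrite map_mx_eq0.
by exists r => //; move: ev; rewrite eigenvalue_map.
Qed.

End Hermitian.

(** * Orthonormal bases *)

Section Orthonormal.
Context {R : realType} {b : base_field}.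
Local Notation K := (RorC R b).

Lemma gram_col n (x : 'cV[K]_n) :
  x != 0 -> exists2 s : R, 0 < s & ctmx x *m x = (of_real b (s ^+ 2))%:M.
Proof.
move=> x0; have [s s0 sx] : exists2 s : R, 0 <= s &
    (ctmx x *m x) 0 0 = of_real b (s ^+ 2).
  apply: nonneg_sqr; rewrite mxE sumr_ge0 // => i _.
  by rewrite !mxE mulrC RorC_conj_ge0.
have xs : ctmx x *m x = (of_real b (s ^+ 2))%:M by rewrite [LHS]mx11_scalar sx.
exists s => //; rewrite lt_def s0 andbT.
apply: contraNneq x0 => sz; apply/eqP/mulctmx_eq0.
by rewrite xs sz expr0n rmorph0 raddf0.
Qed.

Lemma normalize n (x : 'cV[K]_n) :
  x != 0 -> exists a : K, orthonormal_cols (a *: x).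
Proof.
move=> /gram_col[s s0 xs]; exists (of_real b s^-1).
rewrite /orthonormal_cols ctmxZ conj_of_real -scalemxAl -scalemxAr scalerA xs.
by rewrite scale_scalar_mx -!rmorphM -expr2 exprVn mulVf ?rmorph1 // expf_neq0 ?gt_eqF.
Qed.

Lemma orthonormal_row_mx n p q (U : 'M[K]_(n, p)) (W : 'M[K]_(n, q)) :
  orthonormal_cols U -> orthonormal_cols W -> ctmx U *m W = 0 ->
  orthonormal_cols (row_mx U W).
Proof.
rewrite /orthonormal_cols => Uo Wo UW.
have WU : ctmx W *m U = 0 by rewrite -[U]ctmxK -ctmx_mul UW ctmx0.
by rewrite ctmx_row_mx mul_col_row Uo Wo UW WU -scalar_mx_block.
Qed.

Lemma orthonormal_row_mx_orth n p q (U : 'M[K]_(n, p)) (W : 'M[K]_(n, q)) :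
  orthonormal_cols (row_mx U W) -> ctmx W *m U = 0.
Proof.
rewrite /orthonormal_cols ctmx_row_mx mul_col_row scalar_mx_block.
by case/eq_block_mx.
Qed.

(** Gram-Schmidt inside the column space of M: while U has fewer columns than the
    rank of M, some column of M has a nonzero component orthogonal to U, and
    normalizing it gives the next basis vector.  Taking U empty gives
    orthonormal bases; taking M = 1 gives unitary completions. *)
Lemma orthonormal_extend n q (M : 'M[K]_(n, q)) d p (U : 'M[K]_(n, p)) :
  orthonormal_cols U -> colsp_sub U M -> \rank M = (p + d)%N ->
  exists W : 'M[K]_(n, d),
    [/\ orthonormal_cols W, ctmx U *m W = 0 & colsp_sub W M].
Proof.
elim: d p U => [|d IHd] p U Uo UM rM.
  exists 0; split; rewrite /orthonormal_cols ?mulmx0 //.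
  - by apply/matrixP => [[]].
  - by apply/colsp_subP; exists 0; rewrite mulmx0.
(* Otherwise M = U (U^H M) would have rank at most p. *)
have [j xj] : exists j, col j (M - U *m (ctmx U *m M)) != 0.
  apply/existsP; rewrite -negb_forall; apply/negP => /forallP cz.
  have MU : M = U *m (ctmx U *m M).
    apply/eqP; rewrite -subr_eq0; apply/eqP/matrixP => i j.
    by have /eqP/matrixP/(_ i 0) := cz j; rewrite !mxE.
  have := rank_leq_col U; rewrite leqNgt => /negP; apply.
  apply: (@leq_trans (\rank M)); first by rewrite rM addnS ltnS leq_addr.
  by rewrite [in X in (X <= _)%N]MU mxrankM_maxl.
have [a vo] := normalize xj.
set v := a *: _ in vo.
have Uv : ctmx U *m v = 0.
  have z : ctmx U *m (M - U *m (ctmx U *m M)) = 0.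
    by rewrite mulmxBr (mulmxA _ U) Uo mul1mx subrr.
  by rewrite -scalemxAr colE (mulmxA (ctmx U)) z mul0mx scaler0.
have vM : colsp_sub v M.
  have /colsp_subP[D UD] := UM; apply/colsp_subP.
  exists (a *: ((1%:M - D *m (ctmx U *m M)) *m delta_mx j 0)).
  by rewrite -scalemxAr (mulmxA M) mulmxBr mulmx1 (mulmxA M) -UD -colE.
have [|||W [Wo UW WM]] := IHd _ (row_mx U v).
- exact: orthonormal_row_mx.
- have /colsp_subP[D ->] := UM; have /colsp_subP[E ->] := vM.
  by apply/colsp_subP; exists (row_mx D E); rewrite mul_mx_row.
- by rewrite rM addn1 addSnnS.
move: UW; rewrite ctmx_row_mx mul_col_mx -col_mx0 => /eq_col_mx[UW vW].
exists (row_mx v W); split.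
- exact: (orthonormal_row_mx vo Wo vW).
- by have := mul_mx_row (ctmx U) v W; rewrite Uv UW row_mx0.
- have /colsp_subP[D ->] := vM; have /colsp_subP[E ->] := WM.
  by apply/colsp_subP; exists (row_mx D E); exact: (esym (mul_mx_row M D E)).
Qed.

Lemma orthonormal_basis n q (M : 'M[K]_(n, q)) :
  exists2 U : 'M[K]_(n, \rank M), orthonormal_cols U & colsp_eq U M.
Proof.
have [|||U [Uo _ UM]] := @orthonormal_extend n q M (\rank M) 0 0 => //.
- by apply/matrixP => [[]].
- by apply/colsp_subP; exists 0; rewrite mulmx0.
exists U => //; have := mxrank_leqif_eq UM.
by rewrite !mxrank_tr (orthonormal_rank Uo) => /leqif_refl.
Qed.

Lemma unitary_completion n (u : 'cV[K]_(1 + n)) :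
  orthonormal_cols u ->
  exists W : 'M[K]_(1 + n, n), orthonormal_cols (row_mx u W).
Proof.
move=> uo; have [||W [Wo uW _]] := @orthonormal_extend _ _ 1%:M n 1 u uo.
- by apply/colsp_subP; exists u; rewrite mul1mx.
- by rewrite mxrank1.
by exists W; apply: orthonormal_row_mx.
Qed.

End Orthonormal.

(** * Singular value decomposition *)

Section SVD.
Context {R : realType} {b : base_field}.
Local Notation K := (RorC R b).

Definition nonneg_diag p q (S : 'M[R]_(p, q)) :=
  forall (i : 'I_p) (j : 'I_q),
    if i == j :> nat then 0 <= S i j else S i j == 0.

Lemma nonneg_diag_block p q (s : R) (S : 'M[R]_(p, q)) :
  0 <= s -> nonneg_diag S ->
  nonneg_diag (block_mx (s%:M : 'M[R]_1) 0 0 S).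
Proof.
move=> s0 Sd i j.
case: (split_ordP i) => i' ->; case: (split_ordP j) => j' ->.
- by rewrite block_mxEul !ord1 mxE eqxx.
- by rewrite block_mxEur mxE !ord1 /= eqxx.
- by rewrite block_mxEdl mxE !ord1 /= eqxx.
- by rewrite block_mxEdr eqn_add2l; apply: Sd.
Qed.

Definition svd p q (M : 'M[K]_(p, q)) (W : 'M[K]_p) (S : 'M[R]_(p, q))
    (V : 'M[K]_q) : Prop :=
  [/\ orthonormal_cols W, orthonormal_cols V, nonneg_diag S
    & M = W *m map_mx (of_real b) S *m ctmx V].

(** The vector v is a unit eigenvector of M^H M for a nonzero eigenvalue, and
    u = M v / |M v|.  The eigenvalue must be nonzero for u to exist: this is
    why M = 0 is excluded. *)
Lemma singular_pair p q (M : 'M[K]_(p, q)) : M != 0 ->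
  exists (s : R) (u : 'cV[K]_p) (v : 'cV[K]_q),
    [/\ 0 <= s, orthonormal_cols u, orthonormal_cols v,
        M *m v = of_real b s *: u & ctmx M *m u = of_real b s *: v].
Proof.
move=> M0; pose H := ctmx M *m M.
have Hh : ctmx H = H by rewrite ctmx_mul ctmxK.
have H0 : H != 0 by apply: contraNneq M0 => /mulctmx_eq0->.
have [r r0 /eigenvalueP[w wH w0]] := hermitian_eigenvalue Hh H0.
have wz : ctmx w != 0 by apply: contraNneq w0 => h; rewrite -[w]ctmxK h ctmx0.
have [a vo] := normalize wz.
set v := a *: _ in vo.
have Hv : H *m v = of_real b r *: v.
  rewrite -scalemxAr -{1}Hh -ctmx_mul wH ctmxZ conj_of_real scalerA mulrC.
  by rewrite -scalerA.
have Mv0 : M *m v != 0.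
  apply: contra_neq r0 => Mv; apply: (@of_real_inj R b); rewrite rmorph0.
  move: Hv; rewrite /H -mulmxA Mv mulmx0 => /(congr1 (mulmx (ctmx v))).
  rewrite mulmx0 -scalemxAr vo => /matrixP/(_ 0 0); rewrite !mxE eqxx mulr1.
  by move->.
have [s s0 ss] := gram_col Mv0.
have rs : r = s ^+ 2.
  apply: (@of_real_inj R b); move: ss.
  rewrite ctmx_mul -mulmxA (mulmxA (ctmx M)) -/H Hv -scalemxAr vo.
  by move=> /matrixP/(_ 0 0); rewrite !mxE eqxx mulr1 mulr1n.
have s1 : of_real b s * of_real b s^-1 = 1.
  by rewrite -rmorphM mulfV ?rmorph1 // gt_eqF.
exists s, (of_real b s^-1 *: (M *m v)), v; split => //.
- exact: ltW.
- rewrite /orthonormal_cols ctmxZ conj_of_real -scalemxAl -scalemxAr scalerA ss.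
  rewrite scale_scalar_mx expr2 (rmorphM (of_real b)) mulrACA.
  by rewrite ![of_real b s^-1 * _]mulrC s1 mulr1.
- by rewrite scalerA s1 scale1r.
- rewrite -scalemxAr mulmxA Hv scalerA rs expr2 rmorphM mulrCA.
  by rewrite [of_real b s^-1 * _]mulrC s1 mulr1.
Qed.

Lemma svd_zero p q : exists W S V, svd (0 : 'M[K]_(p, q)) W S V.
Proof.
exists 1%:M, 0, 1%:M; split; rewrite /orthonormal_cols ?ctmx1 ?mulmx1 //.
  by move=> i j; rewrite mxE; case: ifP.
by rewrite mul1mx map_mx0.
Qed.

(** In unitary bases that begin with a singular pair (u, v), the matrix M is block
    diagonal, so a decomposition of the lower right block extends to M. *)
Lemma svd_deflation p q (M : 'M[K]_(1 + p, 1 + q)) :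
  M != 0 -> (forall N : 'M[K]_(p, q), exists W S V, svd N W S V) ->
  exists W S V, svd M W S V.
Proof.
move=> M0 IH; have [s [u [v [s0 uo vo Mv Mu]]]] := singular_pair M0.
have [U1 Uo] := unitary_completion uo.
have [V1 Vo] := unitary_completion vo.
have [W [S [V [Wo Vo' Sd E]]]] := IH (ctmx U1 *m M *m V1).
have uM : ctmx u *m M = of_real b s *: ctmx v.
  by rewrite -[M]ctmxK -ctmx_mul Mu ctmxZ conj_of_real.
have block_o n (X : 'M[K]_n) : orthonormal_cols X ->
    orthonormal_cols (block_mx 1%:M 0 0 X : 'M[K]_(1 + n)).
  rewrite /orthonormal_cols => Xo.
  rewrite ctmx_block_mx ctmx1 !ctmx0 mulmx_block !mulmx0 !mul0mx !mulmx1.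
  by rewrite !addr0 !add0r Xo -scalar_mx_block.
have mul_o n (X Y : 'M[K]_n) : orthonormal_cols X -> orthonormal_cols Y ->
    orthonormal_cols (X *m Y).
  rewrite /orthonormal_cols => Xo Yo.
  by rewrite ctmx_mul mulmxA -(mulmxA _ _ X) Xo mulmx1 Yo.
have U1u := orthonormal_row_mx_orth Uo.
have vV1 : ctmx v *m V1 = 0.
  by rewrite -[V1]ctmxK -ctmx_mul (orthonormal_row_mx_orth Vo) ctmx0.
have D : ctmx (row_mx u U1) *m M *m row_mx v V1 =
    block_mx (of_real b s)%:M 0 0 (ctmx U1 *m M *m V1).
  rewrite ctmx_row_mx mul_col_mx mul_col_row uM -!scalemxAl vV1 vo scaler0.
  by rewrite -mulmxA Mv -scalemxAr U1u scaler0 scale_scalar_mx mulr1.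
exists (row_mx u U1 *m block_mx 1%:M 0 0 W).
exists (block_mx (s%:M : 'M[R]_1) 0 0 S).
exists (row_mx v V1 *m block_mx 1%:M 0 0 V); split.
- exact/mul_o/block_o.
- exact/mul_o/block_o.
- exact: nonneg_diag_block.
rewrite map_block_mx map_scalar_mx !map_mx0 ctmx_mul !mulmxA.
rewrite ctmx_block_mx ctmx1 !ctmx0.
rewrite -(mulmxA (row_mx u U1)) mulmx_block -(mulmxA (row_mx u U1)) mulmx_block.
rewrite !(mul0mx, mulmx0, add0r, addr0, mul1mx, mulmx1) -E -D.
rewrite !mulmxA ctmx_unitary_right // mul1mx -mulmxA ctmx_unitary_right //.
by rewrite mulmx1.
Qed.

Lemma svd_ex p q (M : 'M[K]_(p, q)) : exists W S V, svd M W S V.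
Proof.
elim: p q M => [|p IHp] q M; first by rewrite (flatmx0 M); exact: svd_zero.
case: q M => [|q] M; first by rewrite (thinmx0 M); exact: svd_zero.
have [->|M0] := eqVneq M 0; first exact: svd_zero.
exact: (svd_deflation M0 (IHp q)).
Qed.

Lemma nonneg_diag_off p q (S : 'M[R]_(p, q)) (i : 'I_p) (j : 'I_q) :
  nonneg_diag S -> (i != j :> nat) -> S i j = 0.
Proof. by move=> /(_ i j) Sij /negPf ij; move: Sij; rewrite ij => /eqP. Qed.

Lemma nonneg_diag_delta p q (S : 'M[R]_(p, q)) (i : 'I_p) (j : 'I_q) :
  nonneg_diag S -> i = j :> nat -> S *m delta_mx j 0 = S i j *: delta_mx i (0 : 'I_1).
Proof.
move=> Sd ij; rewrite -colE; apply/colP => l; rewrite !mxE eqxx andbT.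
have [->|li] := eqVneq l i; first by rewrite mulr1.
by rewrite mulr0 (nonneg_diag_off Sd) // -ij.
Qed.

Lemma nonneg_diag_tr p q (S : 'M[R]_(p, q)) : nonneg_diag S -> nonneg_diag S^T.
Proof. by move=> Sd i j; rewrite mxE eq_sym; apply: Sd. Qed.

(** The converse direction to [singular_pair]: matching columns of the two unitary
    factors are singular vectors.  All consequences of the definition of a
    singular value are drawn from this form. *)
Lemma singular_value_pair p q (M : 'M[K]_(p, q)) sigma :
  singular_value M sigma ->
  0 <= sigma /\ exists (u : 'cV[K]_p) (v : 'cV[K]_q),
    [/\ orthonormal_cols u, orthonormal_cols v,
        M *m v = of_real b sigma *: u & ctmx M *m u = of_real b sigma *: v].
Proof.
move=> [W [S [V [Wo Vo Sd ME [i [j [ij <-]]]]]]].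
have col_o n (X : 'M[K]_n) l : orthonormal_cols X -> orthonormal_cols (col l X).
  rewrite /orthonormal_cols => Xo; apply/matrixP => k k'; rewrite !ord1.
  have /matrixP/(_ l l) := Xo; rewrite !mxE !eqxx => <-.
  by apply: eq_bigr => h _; rewrite !mxE.
have pair p' q' (N : 'M[K]_(p', q')) W' S' V' (i' : 'I_p') (j' : 'I_q') :
    orthonormal_cols V' -> nonneg_diag S' -> i' = j' :> nat ->
    N = W' *m map_mx (of_real b) S' *m ctmx V' ->
    N *m col j' V' = of_real b (S' i' j') *: col i' W'.
  move=> V'o S'd ij' ->.
  rewrite [in LHS]colE -!mulmxA (mulmxA (ctmx V')) V'o mul1mx.
  rewrite -(map_delta_mx (of_real b)) -map_mxM (nonneg_diag_delta S'd ij').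
  by rewrite map_mxZ map_delta_mx -scalemxAr -colE.
split; first by have := Sd i j; rewrite ij eqxx.
exists (col i W), (col j V); split; [exact: col_o | exact: col_o | exact: pair |].
rewrite (pair _ _ (ctmx M) V S^T W j i) // ?mxE //.
  exact: nonneg_diag_tr.
by rewrite ME !ctmx_mul ctmxK ctmx_of_real mulmxA.
Qed.

Lemma nonneg_diag_cube p q (S : 'M[R]_(p, q)) i j :
  nonneg_diag S -> (S *m S^T *m S) i j = S i j ^+ 3.
Proof.
move=> Sd; have [ij|ij] := eqVneq (i : nat) j.
  have e x : (S *m S^T *m S) x j = (S *m S^T *m S *m delta_mx j 0) x (0 : 'I_1).
    by rewrite -colE [RHS]mxE.
  rewrite e -!mulmxA (nonneg_diag_delta Sd ij) -!scalemxAr.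
  rewrite (nonneg_diag_delta (nonneg_diag_tr Sd) (esym ij)) -scalemxAr.
  by rewrite (nonneg_diag_delta Sd ij) !mxE !eqxx mulr1 !exprS mulr1.
rewrite (nonneg_diag_off Sd ij) expr0n /= mxE big1 // => k _.
have [kj|kj] := eqVneq (k : nat) j; last by rewrite (nonneg_diag_off Sd kj) mulr0.
rewrite mxE big1 ?mul0r // => l _; rewrite mxE.
have [il|il] := eqVneq (i : nat) l; last by rewrite (nonneg_diag_off Sd il) mul0r.
by rewrite (@nonneg_diag_off _ _ _ k l) ?mulr0 // kj -il eq_sym.
Qed.

Lemma cube_fix (s : R) : s ^+ 3 = s -> 0 <= s -> s = 0 \/ s = 1.
Proof.
move=> s3 s0; have : s * ((s - 1) * (s + 1)) = 0.
  by rewrite -subr_sqr_1 mulrBr mulr1 -exprS s3 subrr.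
move/eqP; rewrite !mulf_eq0 => /or3P[/eqP| |s1]; first by left.
  by rewrite subr_eq0 => /eqP; right.
by move: s1; rewrite gt_eqF // ltr_wpDl.
Qed.

(** With M = W S V^H, the matrix M M^H M is W (S S^T S) V^H, whose diagonal entries
    are the cubes of those of S; a nonnegative real equal to its cube is 0 or
    1. *)
Lemma partial_isometryP p q (M : 'M[K]_(p, q)) :
  M *m ctmx M *m M = M <->
  forall sigma, singular_value M sigma -> sigma = 0 \/ sigma = 1.
Proof.
split=> [MMM sigma /singular_value_pair[s0 [u [v [uo vo Mv Mu]]]]|M01].
  apply: cube_fix => //; apply: (@of_real_inj R b).
  have := congr1 (mulmx^~ v) MMM; rewrite /= -!mulmxA Mv -!scalemxAr Mu.
  rewrite -!scalemxAr Mv => /(congr1 (mulmx (ctmx u))).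
  rewrite -!scalemxAr uo => /matrixP/(_ 0 0); rewrite !mxE eqxx mulr1.
  by rewrite !exprS expr0 !rmorphM rmorph1 mulr1.
have [W [S [V [Wo Vo Sd ME]]]] := svd_ex M.
have S3 : S *m S^T *m S = S.
  apply/matrixP => i j; rewrite nonneg_diag_cube //.
  have [ij|ij] := eqVneq (i : nat) j; last first.
    by rewrite (nonneg_diag_off Sd ij) expr0n.
  have [||->] := M01 (S i j); rewrite ?expr1n //; last by move->; rewrite expr0n.
  by exists W, S, V; split => //; exists i, j.
rewrite [in RHS]ME -[S in RHS]S3 !map_mxM ME !ctmx_mul ctmxK ctmx_of_real.
rewrite !mulmxA -[_ *m ctmx V *m V]mulmxA Vo mulmx1.
by rewrite -[_ *m ctmx W *m W]mulmxA Wo mulmx1.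
Qed.

(** If z is a unit right singular vector for sigma, then U z is a unit vector
    whose component y orthogonal to the columns of V has squared length
    1 - sigma^2. *)
Lemma singular_value_le1 n p q (U : 'M[K]_(n, p)) (V : 'M[K]_(n, q)) sigma :
  orthonormal_cols U -> orthonormal_cols V ->
  singular_value (ctmx V *m U) sigma -> 0 <= sigma <= 1.
Proof.
move=> Uo Vo /singular_value_pair[s0 [w [z [wo zo Mz Mw]]]].
rewrite s0 /=; pose y := U *m z - V *m (ctmx V *m (U *m z)).
have yy : ctmx y *m y = (of_real b (1 - sigma ^+ 2))%:M.
  have Vy : ctmx V *m y = 0 by rewrite mulmxBr (mulmxA _ V) Vo mul1mx subrr.
  have -> : ctmx y *m y = ctmx (U *m z) *m y.
    by rewrite {1}/y ctmxB mulmxBl [ctmx (V *m _)]ctmx_mul -mulmxA Vy mulmx0 subr0.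
  rewrite mulmxBr ctmx_mul -!mulmxA (mulmxA (ctmx U) U) Uo mul1mx zo.
  rewrite (mulmxA (ctmx V)) Mz -!scalemxAr.
  have -> : ctmx U *m (V *m w) = of_real b sigma *: z.
    by rewrite -Mw ctmx_mul ctmxK mulmxA.
  rewrite -scalemxAr zo scalerA -(rmorphM (of_real b)) -expr2 scalemx1.
  by rewrite !(rmorphB, rmorph1).
have y0 : 0 <= of_real b (1 - sigma ^+ 2).
  have := congr1 (fun X : 'M[K]_1 => X 0 0) yy; rewrite [in RHS]mxE eqxx mulr1n => <-.
  by rewrite mxE sumr_ge0 // => i _; rewrite !mxE mulrC RorC_conj_ge0.
move: y0; rewrite -(rmorph0 (of_real b)) ler_of_real subr_ge0.
by rewrite -[X in _ <= X](expr1n R 2) ler_pXn2r // nnegrE.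
Qed.

End SVD.

(** * Pairs of orthogonal projections *)

Section Projections.
Context {R : realType} {b : base_field}.
Local Notation K := (RorC R b).

(** If P Q is idempotent, X = P Q - P Q P has X X^H = 0, so P Q = P Q P is
    Hermitian. *)
Lemma proj_mul_idemP n (P Q : 'M[K]_n) :
  orthogonal_projection P -> orthogonal_projection Q ->
  (P *m Q *m P *m Q = P *m Q <-> comm_mx P Q).
Proof.
move=> [PP Ph] [QQ Qh]; split=> [idem|PQ]; last first.
  by rewrite -(mulmxA P Q P) -PQ mulmxA PP -mulmxA QQ.
have /subr0_eq PQP : P *m Q - P *m Q *m P = 0.
  apply: mul_ctmx_eq0; rewrite ctmxB !ctmx_mul Ph Qh.
  rewrite mulmxBl !mulmxBr !mulmxA -!(mulmxA _ P P) PP -(mulmxA P Q Q) QQ.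
  by rewrite idem !subrr.
have PQh : ctmx (P *m Q) = P *m Q by rewrite PQP !ctmx_mul Ph Qh mulmxA.
by rewrite /comm_mx -PQh ctmx_mul Ph Qh.
Qed.

Lemma proj_mul_hermitianP n (P Q : 'M[K]_n) :
  orthogonal_projection P -> orthogonal_projection Q ->
  (ctmx (P *m Q) = P *m Q <-> comm_mx P Q).
Proof.
by move=> [_ Ph] [_ Qh]; rewrite ctmx_mul Ph Qh; split=> /esym.
Qed.

Lemma proj_mul_projP n (P Q : 'M[K]_n) :
  orthogonal_projection P -> orthogonal_projection Q ->
  (orthogonal_projection (P *m Q) <-> comm_mx P Q).
Proof.
move=> hP hQ; split=> [[_ /proj_mul_hermitianP]|PQ]; first exact.
split; first by rewrite mulmxA; apply/proj_mul_idemP.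
exact/proj_mul_hermitianP.
Qed.

(** The minimal polynomial divides X (X - 1), which has simple roots. *)
Lemma idempotent_diagonalizable n (P : 'M[K]_n) :
  P *m P = P -> diagonalizable P.
Proof.
case: n P => [|n] P PP; first by rewrite (flatmx0 P); exact: diagonalizable0.
apply/diagonalizableP; exists [:: 0; 1].
  by rewrite /= inE eq_sym oner_eq0.
apply: mxminpoly_min; rewrite !big_cons big_nil mulr1 subr0 mulrBr mulr1.
by rewrite rmorphB rmorphM /= horner_mx_X (_ : P * P = P) ?subrr.
Qed.

Lemma proj_codiagonalizableP n (P Q : 'M[K]_n) :
  orthogonal_projection P -> orthogonal_projection Q ->
  (codiagonalizable [:: P; Q] <-> comm_mx P Q).
Proof.
move=> [PP _] [QQ _]; rewrite -codiagonalizableP.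
split=> [[comm _]|PQ]; first by apply: comm; rewrite !inE eqxx ?orbT.
split=> [X Y|X]; rewrite !inE.
  by move=> /orP[]/eqP-> /orP[]/eqP->.
by move=> /orP[]/eqP->; exact: idempotent_diagonalizable.
Qed.

Lemma idempotent_eigenvalue n (H : 'M[K]_n) a :
  H *m H = H -> eigenvalue H a -> a = 0 \/ a = 1.
Proof.
move=> HH /eigenvalueP[v vH v0]; have : (a * (a - 1)) *: v = 0.
  rewrite mulrBr mulr1 scalerBl -scalerA -vH scalemxAl -vH -mulmxA HH.
  exact: subrr.
move/eqP; rewrite scaler_eq0 (negPf v0) orbF mulf_eq0 subr_eq0.
by case/orP=> /eqP; [left|right].
Qed.

(** With N = Q P, the compression P Q P is N^H N, so a singular value s of N gives
    the eigenvalue s^2; hence N is a partial isometry, and N N^H N = Q P Q P. *)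
Lemma proj_eigenvalueP n (P Q : 'M[K]_n) :
  orthogonal_projection P -> orthogonal_projection Q ->
  ((forall a, eigenvalue (P *m Q *m P) a -> a = 0 \/ a = 1) <-> comm_mx P Q).
Proof.
move=> hP hQ; have [[PP Ph] [QQ Qh]] := (hP, hQ); split=> [ev|PQ a]; last first.
  apply: idempotent_eigenvalue; rewrite !mulmxA -(mulmxA _ P P) PP.
  by congr (_ *m _); apply/proj_mul_idemP.
suff : Q *m P *m ctmx (Q *m P) *m (Q *m P) = Q *m P.
  rewrite ctmx_mul Ph Qh !mulmxA -(mulmxA _ P P) PP -(mulmxA _ Q Q) QQ.
  by move=> /proj_mul_idemP QP; apply/esym/QP.
apply/partial_isometryP => s /singular_value_pair[s0 [u [v [uo vo Nv Nu]]]].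
have H : ctmx (Q *m P) *m (Q *m P) = P *m Q *m P.
  by rewrite ctmx_mul Ph Qh -!mulmxA (mulmxA Q Q) QQ.
have Hv : (P *m Q *m P) *m v = of_real b (s ^+ 2) *: v.
  by rewrite -H -mulmxA Nv -scalemxAr Nu scalerA -(rmorphM (of_real b)) -expr2.
have [|s2|s2] := ev (of_real b (s ^+ 2)).
- apply/eigenvalueP; exists (ctmx v).
    have := congr1 (@ctmx R b _ _) Hv.
    by rewrite ctmxZ conj_of_real !ctmx_mul Ph Qh !mulmxA.
  apply/negP => /eqP v0; move: vo; rewrite /orthonormal_cols v0 mul0mx.
  by move=> /matrixP/(_ 0 0)/eqP; rewrite !mxE eq_sym oner_eq0.
- left; move: s2; rewrite -(rmorph0 (of_real b)) => /of_real_inj/eqP.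
  by rewrite sqrf_eq0 => /eqP.
- right; move: s2; rewrite -(rmorph1 (of_real b)) => /of_real_inj/eqP.
  rewrite sqrf_eq1 => /orP[/eqP-> //|/eqP sN].
  by move: s0; rewrite sN oppr_ge0 ler10.
Qed.

Lemma penrose_ctmx m n (M : 'M[K]_(m, n)) X :
  penrose M X -> penrose (ctmx M) (ctmx X).
Proof.
by move=> [h1 h2 h3 h4]; split;
  rewrite -!ctmx_mul ?mulmxA ?h1 ?h2 ?h3 ?h4.
Qed.

Lemma mp_inv_hermitian n (S : 'M[K]_n) :
  ctmx S = S -> ctmx (mp_inv S) = mp_inv S.
Proof.
move=> Sh; apply: (@penrose_uniq _ _ _ _ S); last exact: mp_invP.
by rewrite -{1}Sh; apply/penrose_ctmx/mp_invP.
Qed.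

(** The column space of P + Q contains that of P: if E is the projection onto the
    orthogonal complement of the column space of P + Q, then E P E + E Q E = 0 is
    the sum of the positive semidefinite matrices (E P)(E P)^H and
    (E Q)(E Q)^H, so both vanish. *)
Lemma proj_sub_sum n (P Q : 'M[K]_n) :
  orthogonal_projection P -> orthogonal_projection Q ->
  (P + Q) *m mp_inv (P + Q) *m P = P.
Proof.
move=> [PP Ph] [QQ Qh]; have [S1 _ S3 _] := mp_invP (P + Q).
move: (mp_inv _) S1 S3 => T S1 S3.
pose E := 1%:M - (P + Q) *m T.
have Eh : ctmx E = E by rewrite ctmxB ctmx1 S3.
have ES : E *m (P + Q) = 0 by rewrite mulmxBl mul1mx S1 subrr.
have : row_mx (E *m P) (E *m Q) = 0.
  apply: mul_ctmx_eq0; rewrite ctmx_row_mx mul_row_col !ctmx_mul Ph Qh Eh.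
  rewrite !mulmxA -!(mulmxA E) PP QQ !(mulmxA E) -mulmxDl -mulmxDr ES.
  by rewrite mul0mx.
rewrite -[X in _ = X]row_mx0 => /eq_row_mx[+ _].
by rewrite mulmxBl mul1mx => /subr0_eq <-.
Qed.

Lemma proj_sub_sum_r n (P Q : 'M[K]_n) :
  orthogonal_projection P -> orthogonal_projection Q ->
  P *m mp_inv (P + Q) *m (P + Q) = P.
Proof.
move=> hP hQ.
have Sh : ctmx (P + Q) = P + Q by rewrite ctmxD hP.2 hQ.2.
have := congr1 (@ctmx R b _ _) (proj_sub_sum hP hQ).
by rewrite !ctmx_mul Sh (mp_inv_hermitian Sh) hP.2 mulmxA.
Qed.

(** Since P S^+ S = P for S = P + Q, this is P S^+ (S - P) = P - P S^+ P. *)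
Lemma proj_parallel_sum_hermitian n (P Q : 'M[K]_n) :
  orthogonal_projection P -> orthogonal_projection Q ->
  ctmx (P *m mp_inv (P + Q) *m Q) = P *m mp_inv (P + Q) *m Q.
Proof.
move=> hP hQ; have [[PP Ph] [QQ Qh]] := (hP, hQ).
have Sh : ctmx (P + Q) = P + Q by rewrite ctmxD Ph Qh.
have Th := mp_inv_hermitian Sh.
have PTS := proj_sub_sum_r hP hQ.
have -> : P *m mp_inv (P + Q) *m Q = P - P *m mp_inv (P + Q) *m P.
  by rewrite -[in X in X - _]PTS mulmxDr addrAC subrr add0r.
by rewrite ctmxB !ctmx_mul Ph Th mulmxA.
Qed.

(** The right-hand side is Hermitian for all projections P and Q, which forces P Q
    to be Hermitian.  Conversely, if P and Q commute, P Q consists of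
    eigenvectors of S = P + Q for the eigenvalue 2, so 2 S^+ P Q = P Q, and P
    commutes with S^+. *)
Lemma proj_parallel_sumP n (P Q : 'M[K]_n) :
  orthogonal_projection P -> orthogonal_projection Q ->
  (P *m Q = 2 *: (P *m mp_inv (P + Q) *m Q) <-> comm_mx P Q).
Proof.
move=> hP hQ; have [[PP Ph] [QQ Qh]] := (hP, hQ); split=> [h|PQ].
  apply/proj_mul_hermitianP => //; rewrite h ctmxZ.
  by rewrite proj_parallel_sum_hermitian // rmorph_nat.
have Sh : ctmx (P + Q) = P + Q by rewrite ctmxD Ph Qh.
have Th := mp_inv_hermitian Sh.
have STP := proj_sub_sum hP hQ.
have PTS := proj_sub_sum_r hP hQ.
have [_ _ S3 S4] := mp_invP (P + Q).
have TS : mp_inv (P + Q) *m (P + Q) = (P + Q) *m mp_inv (P + Q).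
  by rewrite -S4 ctmx_mul Sh Th.
have PS : P *m (P + Q) = (P + Q) *m P by rewrite mulmxDr mulmxDl PQ.
have PT : P *m mp_inv (P + Q) = mp_inv (P + Q) *m P.
  have -> : mp_inv (P + Q) *m P =
      mp_inv (P + Q) *m (P *m ((P + Q) *m mp_inv (P + Q))).
    by rewrite -TS (mulmxA P) PTS.
  by rewrite (mulmxA P) PS !mulmxA TS STP.
have SPQ : (P + Q) *m (P *m Q) = 2 *: (P *m Q).
  rewrite mulmxDl mulmxA PP PQ mulmxA QQ -PQ.
  by rewrite scaler_nat mulr2n.
by rewrite PT -mulmxA scalemxAr -SPQ !mulmxA TS STP.
Qed.

(** * Principal angles *)

Lemma projection_basis n q p (P : 'M[K]_n) (X : 'M[K]_(n, q))
    (U : 'M[K]_(n, p)) :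
  orthogonal_projection P -> P *m X = X -> colsp_sub P X ->
  orthonormal_cols U -> colsp_eq U X -> P = U *m ctmx U.
Proof.
move=> [_ Ph] PX /colsp_subP[D PXD] Uo /andP[UX XU].
have /colsp_subP[E UE] : colsp_sub U X := UX.
have /colsp_subP[F XF] : colsp_sub X U := XU.
have PU : P *m U = U by rewrite UE mulmxA PX.
have UP : U *m ctmx U *m P = P.
  have -> : P = U *m (F *m D) by rewrite PXD XF mulmxA.
  by rewrite mulmxA -(mulmxA U) Uo mulmx1.
by rewrite -Ph -UP !ctmx_mul ctmxK Ph mulmxA PU.
Qed.

Lemma pihalf_le_pi : pi / 2 <= pi :> R.
Proof. by rewrite ler_pdivrMr // ler_peMr ?pi_ge0 // ler1n. Qed.

Lemma acos_le_pihalf (s : R) : 0 <= s <= 1 -> 0 <= acos s <= pi / 2.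
Proof.
move=> /andP[s0 s1].
have s11 : -1 <= s <= 1 by rewrite s1 andbT (le_trans _ s0) // oppr_le0 ler01.
rewrite acos_ge0 //= leNgt -ltr_cos ?in_itv /=.
- by rewrite acosK // cos_pihalf -leNgt.
- by rewrite pihalf_le_pi andbT divr_ge0 ?pi_ge0.
- by rewrite acos_ge0 ?acos_lepi.
Qed.

Lemma cosine_01 (theta : R) :
  0 <= theta <= pi / 2 ->
  (cos theta = 0 \/ cos theta = 1) -> theta = 0 \/ theta = pi / 2.
Proof.
move=> /andP[t0 tpi] c.
have tc : theta = acos (cos theta).
  by rewrite cosK // in_itv /= t0 (le_trans tpi) // pihalf_le_pi.
by case: c tc => ->; rewrite ?acos0 ?acos1; [right|left].
Qed.

(** With orthonormal bases U and V, P = U U^H and Q = V V^H, so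
    V (N N^H N) U^H = Q P Q P and V N U^H = Q P for N = V^H U: the angles
    are 0 or pi / 2 exactly when N is a partial isometry. *)
Lemma proj_principal_angleP n p q (P Q : 'M[K]_n) (X : 'M[K]_(n, p))
    (Y : 'M[K]_(n, q)) :
  orthogonal_projection P -> P *m X = X -> colsp_sub P X ->
  orthogonal_projection Q -> Q *m Y = Y -> colsp_sub Q Y ->
  ((forall theta : R, principal_angle X Y theta ->
      theta = 0 \/ theta = pi / 2) <-> comm_mx P Q).
Proof.
move=> hP PX XP hQ QY YQ; split=> [ang|PQ theta]; last first.
  move=> [t02 [U [V [Uo UX Vo VY sv]]]]; apply: cosine_01 => //.
  move: (cos theta) sv; apply/partial_isometryP.
  have PE := projection_basis hP PX XP Uo UX.
  have QE := projection_basis hQ QY YQ Vo VY.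
  rewrite ctmx_mul ctmxK !mulmxA -(mulmxA (ctmx V) U) -PE.
  rewrite -(mulmxA _ V) -QE -(mulmxA _ P) PQ QE !mulmxA Vo mul1mx.
  by rewrite PE -!mulmxA Uo mulmx1.
have [U Uo UX] := orthonormal_basis X.
have [V Vo VY] := orthonormal_basis Y.
have PE := projection_basis hP PX XP Uo UX.
have QE := projection_basis hQ QY YQ Vo VY.
suff NNN : ctmx V *m U *m ctmx (ctmx V *m U) *m (ctmx V *m U) = ctmx V *m U.
  apply/esym/(proj_mul_idemP hQ hP).
  have := congr1 (fun N => V *m N *m ctmx U) NNN.
  by rewrite ctmx_mul ctmxK PE QE !mulmxA.
apply/partial_isometryP => s sv.
have s01 := singular_value_le1 Uo Vo sv; have /andP[s0 s1] := s01.
have s11 : s \in `[-1, 1].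
  by rewrite in_itv /= s1 andbT (le_trans _ s0) // oppr_le0 ler01.
have cs : cos (acos s) = s by apply: acosK.
have [|a0|a2] := ang (acos s).
- split; first exact: acos_le_pihalf.
  by exists U, V; rewrite cs.
- by right; rewrite -cs a0 cos0.
- by left; rewrite -cs a2 cos_pihalf.
Qed.

End Projections.

(** * The equivalences *)

Theorem theorem9p6 (R : realType) (b : base_field) (m n k : nat)
    (A : 'M[RorC R b]_(m, n)) (B : 'M[RorC R b]_(n, k)) :
  [<-> (* i *) is_12_inverse (mp_inv B *m mp_inv A) (A *m B);
       (* ii *) is_12_inverse (A *m B) (mp_inv B *m mp_inv A);
       (* iii *) colsp_sub (mp_inv A *m A *m B) B;
       (* iv *) colsp_sub (B *m mp_inv B *m mp_inv A) (mp_inv A);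
       (* v *) forall theta : R, principal_angle (ctmx A) B theta ->
                 theta = 0 \/ theta = pi / 2;
       (* vi *) orthogonal_projection (mp_inv A *m A *m B *m mp_inv B);
       (* vii *) orthogonal_projection (B *m mp_inv B *m mp_inv A *m A);
       (* viii *) comm_mx (mp_inv A *m A) (B *m mp_inv B);
       (* ix *) codiagonalizable [:: mp_inv A *m A; B *m mp_inv B];
       (* x *) mp_inv A *m A *m B *m mp_inv B =
                 2 *: (mp_inv A *m A *m mp_inv (mp_inv A *m A + B *m mp_inv B)
                         *m B *m mp_inv B);
       (* xi *) mp_inv A *m A *m B *m mp_inv B *m mp_inv A *m A *m B *m mp_inv B =
                  B *m mp_inv B *m mp_inv A *m A;
       (* xii *) forall a : RorC R b,
                   eigenvalue (mp_inv A *m A *m B *m mp_inv B *m mp_inv A *m A) a ->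
                   a = 0 \/ a = 1].
Proof.
have [A1 A2 _ A4] := mp_invP A; have [B1 B2 B3 _] := mp_invP B.
move: (mp_inv A) (mp_inv B) A1 A2 A4 B1 B2 B3 => Ap Bp A1 A2 A4 B1 B2 B3.
(* P and Q are opaque, so that reassociation never looks inside them. *)
have [P Pdef] : exists P, P = Ap *m A by exists (Ap *m A).
have [Q Qdef] : exists Q, Q = B *m Bp by exists (B *m Bp).
have hP : orthogonal_projection P by split; rewrite Pdef ?mulmxA ?A2.
have hQ : orthogonal_projection Q by split; rewrite Qdef ?mulmxA ?B1.
have assocPQ : Ap *m A *m B *m Bp = P *m Q by rewrite Pdef Qdef !mulmxA.
have assocQP : B *m Bp *m Ap *m A = Q *m P by rewrite Pdef Qdef !mulmxA.
have commC (X Y : 'M[RorC R b]_n) : comm_mx X Y <-> comm_mx Y X by split=> /esym.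
have AP : A *m P = A by rewrite Pdef mulmxA.
have PAp : P *m Ap = Ap by rewrite Pdef.
have QB : Q *m B = B by rewrite Qdef.
have BpQ : Bp *m Q = Bp by rewrite Qdef mulmxA.
have c1 : is_12_inverse (Bp *m Ap) (A *m B) <-> comm_mx P Q.
  split=> [[ABAB _]|PQ].
    apply/(proj_mul_idemP hP hQ).
    have := congr1 (fun X => Ap *m X *m Bp) ABAB.
    by rewrite Pdef Qdef !mulmxA.
  split.
    have -> : A *m B *m (Bp *m Ap) *m (A *m B) = A *m (Q *m P) *m B.
      by rewrite Pdef Qdef !mulmxA.
    by rewrite -PQ (mulmxA A) AP -mulmxA QB.
  have -> : Bp *m Ap *m (A *m B) *m (Bp *m Ap) = Bp *m (P *m Q) *m Ap.
    by rewrite Pdef Qdef !mulmxA.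
  by rewrite PQ (mulmxA Bp) BpQ -mulmxA PAp.
have c2 : is_12_inverse (A *m B) (Bp *m Ap) <-> comm_mx P Q.
  by rewrite -c1; split=> [[]|[]].
have c3 : colsp_sub (Ap *m A *m B) B <-> comm_mx P Q.
  rewrite -Pdef; split=> [/colsp_subP[D PB]|PQ].
    apply/(proj_mul_idemP hP hQ).
    have QPB : Q *m (P *m B) = P *m B by rewrite PB mulmxA QB.
    have PBBp : P *m Q = P *m B *m Bp by rewrite Qdef mulmxA.
    have QPQ : Q *m (P *m Q) = P *m Q by rewrite PBBp mulmxA QPB.
    by rewrite -!mulmxA QPQ mulmxA hP.1.
  apply/colsp_subP; exists (Bp *m P *m B).
  by rewrite -{1}QB mulmxA PQ {1}Qdef !mulmxA.
have c4 : colsp_sub (B *m Bp *m Ap) Ap <-> comm_mx P Q.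
  rewrite -Qdef; split=> [/colsp_subP[D QA]|PQ].
    apply/commC/(proj_mul_idemP hQ hP).
    have PQA : P *m (Q *m Ap) = Q *m Ap by rewrite QA mulmxA PAp.
    have QApA : Q *m P = Q *m Ap *m A by rewrite Pdef mulmxA.
    have PQP : P *m (Q *m P) = Q *m P by rewrite QApA mulmxA PQA.
    by rewrite -!mulmxA PQP mulmxA hQ.1.
  apply/colsp_subP; exists (A *m Q *m Ap).
  by rewrite -{1}PAp mulmxA -PQ {1}Pdef !mulmxA.
have c5 : (forall theta : R, principal_angle (ctmx A) B theta ->
                 theta = 0 \/ theta = pi / 2) <-> comm_mx P Q.
  apply: proj_principal_angleP => //.
  - by rewrite -{1}hP.2 -ctmx_mul Pdef mulmxA A1.
  - by apply/colsp_subP; exists (ctmx Ap); rewrite -ctmx_mul -Pdef hP.2.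
  - by apply/colsp_subP; exists Bp.
have c6 : orthogonal_projection (Ap *m A *m B *m Bp) <-> comm_mx P Q.
  by rewrite assocPQ; exact: proj_mul_projP.
have c7 : orthogonal_projection (B *m Bp *m Ap *m A) <-> comm_mx P Q.
  by rewrite assocQP commC; exact: proj_mul_projP.
have c8 : comm_mx (Ap *m A) (B *m Bp) <-> comm_mx P Q by rewrite Pdef Qdef.
have c9 : codiagonalizable [:: Ap *m A; B *m Bp] <-> comm_mx P Q.
  by rewrite -Pdef -Qdef; exact: proj_codiagonalizableP.
have c10 : Ap *m A *m B *m Bp =
    2 *: (Ap *m A *m mp_inv (Ap *m A + B *m Bp) *m B *m Bp) <-> comm_mx P Q.
  rewrite assocPQ -(mulmxA _ B) -Pdef -Qdef; exact: proj_parallel_sumP.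
have c11 : Ap *m A *m B *m Bp *m Ap *m A *m B *m Bp = B *m Bp *m Ap *m A <->
    comm_mx P Q.
  have -> : Ap *m A *m B *m Bp *m Ap *m A *m B *m Bp = P *m Q *m P *m Q.
    by rewrite Pdef Qdef !mulmxA.
  rewrite assocQP; split=> [PQPQ|PQ].
    have QP : P *m (Q *m P) = Q *m P by rewrite -PQPQ !mulmxA hP.1.
    apply/commC/(proj_mul_idemP hQ hP).
    by rewrite -!mulmxA QP mulmxA hQ.1.
  by rewrite -PQ; apply/proj_mul_idemP.
have c12 : (forall a, eigenvalue (Ap *m A *m B *m Bp *m Ap *m A) a ->
              a = 0 \/ a = 1) <-> comm_mx P Q.
  have -> : Ap *m A *m B *m Bp *m Ap *m A = P *m Q *m P.
    by rewrite Pdef Qdef !mulmxA.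
  exact: proj_eigenvalueP.
tfae.
- by move=> /c1 h; apply/c2.
- by move=> /c2 h; apply/c3.
- by move=> /c3 h; apply/c4.
- by move=> /c4 h; apply/c5.
- by move=> /c5 h; apply/c6.
- by move=> /c6 h; apply/c7.
- by move=> /c7 h; apply/c8.
- by move=> /c8 h; apply/c9.
- by move=> /c9 h; apply/c10.
- by move=> /c10 h; apply/c11.
- by move=> /c11 h; apply/c12.
- by move=> /c12 h; apply/c1.
Qed.
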